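(* Let $\mathcal{N}$ be a connected plane Euclidean network with locus $\mathcal{N}_{\ell}$. The following statements are equivalent: (i) $\mathcal{N}_{\ell}$ admits a shortcut set; (ii) for any two diametral vertices $u,v$ of $\mathcal{N}_{\ell}$, the straight segment $uv$ is not contained in $\mathcal{N}_{\ell}$; (iii) $\mathrm{diam}(CH(\mathcal{N}_{\ell}))<\mathrm{diam}(\mathcal{N}_{\ell})$.
   Context: A plane Euclidean network $\mathcal{N}$ is a finite graph whose vertices are points of $\mathbb{R}^2$ and whose edges are straight-line segments between their endpoints, with no two edges crossing; each edge has length equal to the Euclidean distance between its endpoints. Its locus $\mathcal{N}_{\ell}$ is the closed set of all points of $\mathbb{R}^2$ lying on $\mathcal{N}$ (vertices and all points of edges). For a closed union $X$ of finitely many segments (treated as a network in which all intersection points of segments are points of the network), the distance $d_X(p,q)$ between $p,q\in X$ is the length of a shortest path from $p$ to $q$ within $X$; the eccentricity is $\mathrm{ecc}(p)=\max_{q\in X} d_X(p,q)$, and $\mathrm{diam}(X)=\max_{p\in X}\mathrm{ecc}(p)$. Two points $p,q$ of $\mathcal{N}_{\ell}$ are diametral if $d(p,q)=\mathrm{diam}(\mathcal{N}_{\ell})$; if moreover they are vertices of $\mathcal{N}$, they are diametral vertices. $CH(\mathcal{N}_{\ell})$ is the convex hull of $\mathcal{N}_{\ell}$, and $\mathrm{diam}(CH(\mathcal{N}_{\ell}))$ is its Euclidean diameter. A shortcut set for $\mathcal{N}_{\ell}$ is a finite set $\mathcal{S}=\{s_1,\dots,s_k\}$ of straight segments such that $s_1$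 has both endpoints on $\mathcal{N}_{\ell}$, each $s_i$ ($2\le i\le k$) has both endpoints on $\mathcal{N}_{\ell}\cup s_1\cup\dots\cup s_{i-1}$, and $\mathrm{diam}(\mathcal{N}_{\ell}\cup\mathcal{S})<\mathrm{diam}(\mathcal{N}_{\ell})$, where $\mathcal{N}_{\ell}\cup\mathcal{S}$ is the union of $\mathcal{N}_{\ell}$ and the segments, viewed as a network with all intersection points as network points. *)

(* Defs.v *)
From HB Require Import structures.
From mathcomp Require Import all_boot all_order all_algebra.
From mathcomp Require Import finmap.
From mathcomp Require Import all_classical all_reals.
From mathcomp Require Import convex.

Set Implicit Arguments.
Unset Strict Implicit.
Unset Printing Implicit Defensive.

Import Order.TTheory GRing.Theory Num.Theory.

Local Open Scope classical_set_scope.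
Local Open Scope ring_scope.

Section PlaneGeometry.
Context {R : realType}.
Implicit Types (p q : 'rV[R]_2) (X : set 'rV[R]_2).

(* The library norm on row vectors is the sup norm, hence this definition. *)
Definition eucl_dist p q : R :=
  Num.sqrt (\sum_(i < 2) (p 0 i - q 0 i) ^+ 2).

Definition segment p q : set 'rV[R]_2 :=
  [set (1 - t) *: p + t *: q | t in [set t : R | 0 <= t <= 1]].

Definition convex_hull X : set 'rV[R]_2 :=
  smallest (@convex_set R 'rV[R]_2) X.

Definition eucl_diam X : R :=
  sup [set d | exists p q, [/\ X p, X q & d = eucl_dist p q]].

(* The polygonal path p, s_0, s_1, ... stays inside X. In a finite union of
   segments these are the paths of the associated network, whose points may
   subdivide the segments anywhere. *)
Fixpoint path_in X p (s : seq 'rV[R]_2) : Prop :=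
  if s is q :: s' then segment p q `<=` X /\ path_in X q s' else X p.

Fixpoint path_length p (s : seq 'rV[R]_2) : R :=
  if s is q :: s' then eucl_dist p q + path_length q s' else 0.

(* For X a connected finite union of segments, which is the only case used,
   the infimum and the suprema below are a minimum and maxima. *)
Definition net_dist X p q : R :=
  inf [set path_length p s | s in [set s | path_in X p s /\ last p s = q]].

Definition ecc X p : R := sup [set net_dist X p q | q in X].

Definition net_diam X : R := sup [set ecc X p | p in X].

Definition diametral X p q : Prop :=
  [/\ X p, X q & net_dist X p q = net_diam X].

(* A segment is given by its pair of endpoints. *)
Definition add_segments X (S : seq ('rV[R]_2 * 'rV[R]_2)) : set 'rV[R]_2 :=
  X `|` [set x | exists2 e, e \in S & segment e.1 e.2 x].

Fixpoint attached X (S : seq ('rV[R]_2 * 'rV[R]_2)) : Prop :=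
  if S is e :: S' then
    [/\ X e.1, X e.2 & attached (X `|` segment e.1 e.2) S']
  else True.

Definition shortcut_set X (S : seq ('rV[R]_2 * 'rV[R]_2)) : Prop :=
  attached X S /\ net_diam (add_segments X S) < net_diam X.

End PlaneGeometry.

Record network (R : realType) := Network {
  vertices : {fset 'rV[R]_2};
  adj : rel 'rV[R]_2;
  adj_sym : symmetric adj;
  adj_irrefl : irreflexive adj;
  adj_vertex : forall u v, adj u v -> u \in vertices }.

Section Networks.
Context {R : realType}.
Implicit Type N : network R.

Definition locus N : set 'rV[R]_2 :=
  [set x | x \in vertices N] `|`
  [set x | exists u v, adj N u v /\ segment u v x].

(* Distinct edges meet at most in common endpoints. *)
Definition plane N : Prop :=
  forall a b c d, adj N a b -> adj N c d ->
    (a, b) <> (c, d) -> (a, b) <> (d, c) ->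
    forall x, segment a b x -> segment c d x ->
      x \in [:: a; b] /\ x \in [:: c; d].

Definition graph_connected N : Prop :=
  (exists u, u \in vertices N) /\
  forall u v, u \in vertices N -> v \in vertices N ->
    exists2 s, path (adj N) u s & last u s = v.

End Networks.

(* Main.v *)
(** The hull has the diameter [h] of the vertex set, attained by two vertices
    [u] and [v], and network distances dominate Euclidean ones. If [h] equals
    the network diameter, then added segments cannot bring [u] and [v] closer
    than [h], and [u] and [v] are diametral at network distance [|uv|], which
    forces the segment [uv] to lie on the closed locus.

    If [h] is smaller than the network diameter, subdivide all segments between
    two vertices finely and add all segments between subdivision points. The
    fan of segments from a subdivision point [c] cuts the hull into thin
    triangles; a point [p] of the new network in such a triangle follows its
    own segment towards [c] until it meets a side of the triangle, so its
    distance to [c] is almost [|pc|]. For two points [p] and [q], the line [pq]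
    leaves the hull at [e] and [e'], and the detours [p e q] and [p e' q] have
    total length [2 |ee'| <= 2 h]; hence [p] and [q] are at network distance at
    most [h] up to a small error. *)

Require Import Defs.
From mathcomp Require Import all_boot all_order all_algebra.
From mathcomp Require Import finmap.
From mathcomp Require Import all_classical all_reals.
From mathcomp Require Import interval_inference convex.
From mathcomp Require Import ring lra.

Set Implicit Arguments.
Unset Strict Implicit.
Unset Printing Implicit Defensive.

Import Order.TTheory GRing.Theory Num.Theory.

Local Open Scope classical_set_scope.
Local Open Scope ring_scope.

(** * Euclidean distance and segments in the plane *)

Section EuclideanPlane.
Context {R : realType}.
Implicit Types (p q x y z a b c : 'rV[R]_2) (X : set 'rV[R]_2).

Lemma row2P p q : p 0 0 = q 0 0 -> p 0 1 = q 0 1 -> p = q.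
Proof.
move=> h0 h1; apply/rowP => -[[|[|//]] hi].
- by rewrite (_ : Ordinal hi = 0) //; apply: val_inj.
- by rewrite (_ : Ordinal hi = 1) //; apply: val_inj.
Qed.

Lemma eucl_distE p q :
  eucl_dist p q = Num.sqrt ((p 0 0 - q 0 0) ^+ 2 + (p 0 1 - q 0 1) ^+ 2).
Proof.
rewrite /eucl_dist big_ord_recl big_ord1.
by rewrite (_ : lift ord0 ord0 = 1) //; apply: val_inj.
Qed.

Lemma eucl_dist_ge0 p q : 0 <= eucl_dist p q.
Proof. exact: sqrtr_ge0. Qed.

Lemma sqr_eucl_dist p q :
  eucl_dist p q ^+ 2 = (p 0 0 - q 0 0) ^+ 2 + (p 0 1 - q 0 1) ^+ 2.
Proof. by rewrite eucl_distE sqr_sqrtr // addr_ge0 // sqr_ge0. Qed.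

Lemma eucl_distC p q : eucl_dist p q = eucl_dist q p.
Proof. by rewrite !eucl_distE; congr Num.sqrt; ring. Qed.

Lemma eucl_distxx p : eucl_dist p p = 0.
Proof. by rewrite eucl_distE !subrr expr0n addr0 sqrtr0. Qed.

Lemma eucl_dist_eq0 p q : eucl_dist p q = 0 -> p = q.
Proof.
move=> h; have /esym/eqP := sqr_eucl_dist p q.
rewrite h expr0n paddr_eq0 ?sqr_ge0 // !sqrf_eq0 !subr_eq0.
by move=> /andP[/eqP h0 /eqP h1]; exact: row2P.
Qed.

Lemma eucl_dist_triangle y x z : eucl_dist x z <= eucl_dist x y + eucl_dist y z.
Proof.
have hx := eucl_dist_ge0 x y; have hy := eucl_dist_ge0 y z.
have hz := eucl_dist_ge0 x z.
have := sqr_eucl_dist x y; have := sqr_eucl_dist y z.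
have := sqr_eucl_dist x z.
move: (eucl_dist x y) (eucl_dist y z) (eucl_dist x z) hx hy hz => A B C A0 B0 C0.
set a := x 0 0 - y 0 0; set b := x 0 1 - y 0 1.
set c := y 0 0 - z 0 0; set d := y 0 1 - z 0 1.
rewrite (_ : x 0 0 - z 0 0 = a + c); last by rewrite /a /c; ring.
rewrite (_ : x 0 1 - z 0 1 = b + d); last by rewrite /b /d; ring.
move=> hC hB hA.
(* Cauchy-Schwarz by Lagrange's identity: the squares of the two sides differ by
   [(a * d - b * c) ^+ 2]. *)
have CS : a * c + b * d <= A * B.
  rewrite leNgt; apply/negP => lt.
  have AB0 : 0 <= A * B by apply: mulr_ge0.
  have : (A * B) ^+ 2 < (a * c + b * d) ^+ 2 by nra.
  rewrite exprMn hA hB; have := sqr_ge0 (a * d - b * c); nra.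
by rewrite -(@ler_pXn2r _ 2) ?nnegrE ?addr_ge0 //; nra.
Qed.

Lemma eucl_distZ t p q : eucl_dist (t *: p) (t *: q) = `|t| * eucl_dist p q.
Proof.
rewrite !eucl_distE !mxE -sqrtr_sqr -sqrtrM ?sqr_ge0 //.
by congr Num.sqrt; ring.
Qed.

Lemma eucl_distDr p q x : eucl_dist (p + x) (q + x) = eucl_dist p q.
Proof. by rewrite !eucl_distE !mxE; congr Num.sqrt; ring. Qed.

Lemma eucl_distDl p q x : eucl_dist (x + p) (x + q) = eucl_dist p q.
Proof. by rewrite ![x + _]addrC eucl_distDr. Qed.

(** Going through the mixed point [(1 - t) *: p' + t *: q] changes only one endpoint at a time. This
    joint convexity makes balls convex. *)
Lemma eucl_dist_conv t p q p' q' : 0 <= t <= 1 ->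
  eucl_dist ((1 - t) *: p + t *: q) ((1 - t) *: p' + t *: q') <=
  (1 - t) * eucl_dist p p' + t * eucl_dist q q'.
Proof.
move=> /andP[t0 t1].
apply: le_trans (eucl_dist_triangle ((1 - t) *: p' + t *: q) _ _) _.
by rewrite eucl_distDr eucl_distDl !eucl_distZ !ger0_norm ?subr_ge0.
Qed.

Lemma scale_onemxx t p : (1 - t) *: p + t *: p = p.
Proof. by rewrite -scalerDl subrK scale1r. Qed.

Lemma eucl_dist_convl t p q : 0 <= t ->
  eucl_dist p ((1 - t) *: p + t *: q) = t * eucl_dist p q.
Proof.
move=> t0; rewrite -{1}(scale_onemxx t p).
by rewrite eucl_distDl eucl_distZ ger0_norm.
Qed.

Lemma eucl_dist_convr t p q : t <= 1 ->
  eucl_dist ((1 - t) *: p + t *: q) q = (1 - t) * eucl_dist p q.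
Proof.
move=> t1; rewrite -{2}(scale_onemxx t q).
by rewrite eucl_distDr eucl_distZ ger0_norm // subr_ge0.
Qed.

Lemma segment_dist p q x : segment p q x ->
  eucl_dist p x + eucl_dist x q = eucl_dist p q.
Proof.
case=> t /= /andP[t0 t1] <-.
by rewrite eucl_dist_convl // eucl_dist_convr //; ring.
Qed.

Lemma segment_conv t p q : 0 <= t <= 1 -> segment p q ((1 - t) *: p + t *: q).
Proof. by move=> h; exists t. Qed.

Lemma segment_left p q : segment p q p.
Proof. by exists 0; rewrite /= ?lexx ?ler01 // subr0 scale1r scale0r addr0. Qed.

Lemma segment_right p q : segment p q q.
Proof. by exists 1; rewrite /= ?lexx ?ler01 // subrr scale1r scale0r add0r. Qed.

Lemma segmentC p q : segment p q = segment q p.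
Proof.
have H a b : segment a b `<=` segment b a.
  move=> _ [t /= /andP[t0 t1] <-]; exists (1 - t); first by rewrite /=; lra.
  by apply: row2P; rewrite !mxE; ring.
by rewrite eqEsubset.
Qed.

Lemma segmentxx p : segment p p = [set p].
Proof.
rewrite eqEsubset; split; last by move=> _ ->; exact: segment_left.
by move=> _ [t _ <-]; rewrite scale_onemxx.
Qed.

Lemma segment_sub p q a b : segment p q a -> segment p q b ->
  segment a b `<=` segment p q.
Proof.
move=> [s /= /andP[s0 s1] <-] [t /= /andP[t0 t1] <-] _ [w /= /andP[w0 w1] <-].
exists ((1 - w) * s + w * t); first by rewrite /=; nra.
by apply: row2P; rewrite !mxE; ring.
Qed.

Lemma segment_ball p q x z d :
  segment p q x -> eucl_dist p z <= d -> eucl_dist q z <= d ->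
  eucl_dist x z <= d.
Proof.
move=> [t /= /andP[t0 t1] <-] hp hq; rewrite -[z](scale_onemxx t).
apply: le_trans (eucl_dist_conv _ _ _ _ _) _; first by rewrite t0.
nra.
Qed.

(* The point of a segment nearest to [z] has parameter [t0], the parameter
   of the orthogonal projection of [z] clipped to [0, 1]. *)
Lemma segment_separated p q z : ~ segment p q z ->
  exists2 r, 0 < r & forall x, segment p q x -> r <= eucl_dist z x.
Proof.
move=> hz.
have [t0 t01 ht0] : exists2 t0, 0 <= t0 <= 1 & forall t, 0 <= t <= 1 ->
    eucl_dist z ((1 - t0) *: p + t0 *: q) <= eucl_dist z ((1 - t) *: p + t *: q).
  set A := (q 0 0 - p 0 0) ^+ 2 + (q 0 1 - p 0 1) ^+ 2.
  set B := (z 0 0 - p 0 0) * (q 0 0 - p 0 0) + (z 0 1 - p 0 1) * (q 0 1 - p 0 1).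
  have A0 : 0 <= A by rewrite addr_ge0 // sqr_ge0.
  (* Up to a constant, the squared distance from [z] to the point of parameter [t] is
     [A * t ^+ 2 - 2 * B * t]; the hypothesis compares this quadratic at [s] and [t]. *)
  have key t s : A * (s ^+ 2 - t ^+ 2) - 2 * (s - t) * B <= 0 ->
      eucl_dist z ((1 - s) *: p + s *: q) <= eucl_dist z ((1 - t) *: p + t *: q).
    move=> h; rewrite !eucl_distE ler_sqrt; last by rewrite addr_ge0 // sqr_ge0.
    by rewrite !mxE -subr_le0; apply: le_trans h; rewrite /A /B le_eqVlt;
      apply/orP; left; apply/eqP; ring.
  have [B0|B0] := lerP B 0.
    by exists 0; [rewrite lexx ler01|move=> t /andP[? ?]; apply: key; nra].
  have [AB|AB] := lerP A B.
    exists 1; [by rewrite lexx ler01|move=> t /andP[t0 t1]; apply: key].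
    have : 0 <= (1 - t) * (B - A) by rewrite mulr_ge0 ?subr_ge0.
    have : 0 <= A * (1 - t) ^+ 2 by rewrite mulr_ge0 // sqr_ge0.
    nra.
  have AP : 0 < A by lra.
  exists (B / A).
    by rewrite ler_pdivrMr // mul1r (ltW AB) andbT divr_ge0 // ltW.
  move=> t _; apply: key.
  have : 0 <= A * (t - B / A) ^+ 2 by rewrite mulr_ge0 // sqr_ge0.
  have : A * (B / A) = B by rewrite mulrC divfK // gt_eqF.
  move: (B / A) => s hs; nra.
exists (eucl_dist z ((1 - t0) *: p + t0 *: q)).
  rewrite lt_neqAle eucl_dist_ge0 andbT eq_sym; apply/eqP => /eucl_dist_eq0 e.
  by apply: hz; rewrite e; exact: segment_conv.
by move=> _ [t /= ht <-]; exact: ht0.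
Qed.

End EuclideanPlane.

(** * Polygonal paths and network distance *)

Section Paths.
Context {R : realType}.
Implicit Types (p q x y z : 'rV[R]_2) (X Y : set 'rV[R]_2).

(** Upper bounds on network distance are carried by witnessing paths: these concatenate, reverse and
    survive enlarging [X], and they keep the infimum in [net_dist] from being taken over the empty
    set, where it would be 0. *)
Definition joined X p q (d : R) : Prop :=
  exists s, [/\ path_in X p s, last p s = q & path_length p s <= d].

Lemma path_length_ge0 p s : 0 <= path_length p s.
Proof. by elim: s p => //= q s IH p; rewrite addr_ge0 // eucl_dist_ge0. Qed.

Lemma eucl_dist_le_path p s : eucl_dist p (last p s) <= path_length p s.
Proof.
elim: s p => [|q s IH] p /=; first by rewrite eucl_distxx.
by apply: le_trans (eucl_dist_triangle q _ _) _; rewrite lerD2l.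
Qed.

Lemma path_in_cat X p s s' : path_in X p s -> path_in X (last p s) s' ->
  path_in X p (s ++ s').
Proof. by elim: s p => //= q s IH p [h1 h2] h3; split=> //; exact: IH. Qed.

Lemma path_length_cat p s s' :
  path_length p (s ++ s') = path_length p s + path_length (last p s) s'.
Proof. by elim: s p => /= [|q s IH] p; rewrite ?add0r // IH addrA. Qed.

Lemma path_in_sub X Y p s : X `<=` Y -> path_in X p s -> path_in Y p s.
Proof.
move=> XY; elim: s p => [|q s IH] p /=; first exact: XY.
by move=> [h1 h2]; split; [exact: subset_trans h1 XY|exact: IH].
Qed.

Lemma joined_refl X p : X p -> joined X p p 0.
Proof. by move=> Xp; exists [::]. Qed.

Lemma joined_segment X p q : segment p q `<=` X -> joined X p q (eucl_dist p q).
Proof.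
move=> h; exists [:: q]; split => //=; last by rewrite addr0.
by split=> //; apply: h; exact: segment_right.
Qed.

Lemma joined_trans X p q x d d' :
  joined X p q d -> joined X q x d' -> joined X p x (d + d').
Proof.
move=> [s [h1 <- h3]] [s' [h4 h5 h6]]; exists (s ++ s'); split.
- exact: path_in_cat.
- by rewrite last_cat.
- by rewrite path_length_cat lerD.
Qed.

Lemma joined_le X p q d d' : d <= d' -> joined X p q d -> joined X p q d'.
Proof. by move=> h [s [h1 h2 h3]]; exists s; split=> //; exact: le_trans h. Qed.

Lemma joined_sub X Y p q d : X `<=` Y -> joined X p q d -> joined Y p q d.
Proof. by move=> h [s [h1 h2 h3]]; exists s; split=> //; exact: path_in_sub h1. Qed.

Lemma joined_sym X p q d : joined X p q d -> joined X q p d.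
Proof.
move=> [s [h1 h2 h3]]; apply: joined_le h3 _.
elim: s p h1 h2 => [|x s IH] p /=; first by move=> ? <-; exact: joined_refl.
move=> [h1 h2] h3; rewrite addrC; apply: joined_trans (IH _ h2 h3) _.
by rewrite eucl_distC; apply: joined_segment; rewrite segmentC.
Qed.

Lemma joined_ge_dist X p q d : joined X p q d -> eucl_dist p q <= d.
Proof. by move=> [s [_ <-]]; apply: le_trans; exact: eucl_dist_le_path. Qed.

Lemma net_dist_le X p q d : joined X p q d -> net_dist X p q <= d.
Proof.
move=> [s [h1 h2 h3]]; apply: le_trans h3; apply: ge_inf; last by exists s.
by exists 0 => _ [s' _ <-]; exact: path_length_ge0.
Qed.

Lemma net_dist_ge X p q d : joined X p q d -> eucl_dist p q <= net_dist X p q.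
Proof.
move=> [s [h1 h2 h3]]; apply: lb_le_inf; first by exists (path_length p s), s.
by move=> _ [s' [_ <-] <-]; exact: eucl_dist_le_path.
Qed.

Lemma net_dist_adherent X p q d e : joined X p q d -> net_dist X p q < e ->
  joined X p q e.
Proof.
move=> [s [h1 h2 h3]] /inf_lt[|_ [s' [h4 h5] <-] lt].
  by exists (path_length p s), s.
by exists s'; split=> //; exact: ltW.
Qed.

(** Intermediate values of an affine function along a path: on the edge where [f] first becomes
    positive its zero is explicit, and cutting the path there bounds the two straight distances. *)
Lemma path_crosses X (f : 'rV[R]_2 -> R) p s :
  (forall t x y, f ((1 - t) *: x + t *: y) = (1 - t) * f x + t * f y) ->
  path_in X p s -> f p <= 0 -> 0 <= f (last p s) ->
  exists w, [/\ X w, f w = 0 &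
    eucl_dist p w + eucl_dist w (last p s) <= path_length p s].
Proof.
move=> fconv; elim: s p => [|q s IH] p /=.
  move=> Xp h1 h2; exists p; rewrite eucl_distxx addr0.
  by split=> //; apply/eqP; rewrite eq_le h1.
move=> [hpq hs] fp fl; have [fq|fq] := lerP (f q) 0.
  have [w [Xw fw hw]] := IH _ hs fq fl; exists w; split=> //.
  have := eucl_dist_triangle q p w; lra.
have dp : 0 < f q - f p by lra.
pose t := - f p / (f q - f p).
have t01 : 0 <= t <= 1.
  apply/andP; split; first by apply: divr_ge0; lra.
  by rewrite ler_pdivrMr // mul1r; lra.
have hw := segment_conv p q t01.
exists ((1 - t) *: p + t *: q); split; first exact: hpq.
  by rewrite fconv /t; field; rewrite gt_eqF.
have := segment_dist hw; have := eucl_dist_le_path q s.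
have := eucl_dist_triangle q ((1 - t) *: p + t *: q) (last q s); lra.
Qed.

(* A path avoiding a ball around [z] crosses the perpendicular to [uv] at [z]
   far from [z], which costs a fixed extra length. *)
Lemma net_dist_straight X u v d :
  (forall z, ~ X z -> exists2 r, 0 < r & forall x, X x -> r <= eucl_dist z x) ->
  joined X u v d -> net_dist X u v <= eucl_dist u v -> segment u v `<=` X.
Proof.
move=> Xcl juv duv z zuv; apply: contrapT => /Xcl[r r0 hr].
pose A := eucl_dist u z; pose B := eucl_dist z v.
have A0 : 0 <= A by exact: eucl_dist_ge0.
have B0 : 0 <= B by exact: eucl_dist_ge0.
have AB : A + B = eucl_dist u v by exact: segment_dist.
have pos C : 0 <= C -> C < Num.sqrt (C ^+ 2 + r ^+ 2).
  move=> C0; rewrite -{1}(ger0_norm C0) -sqrtr_sqr ltr_sqrt.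
    by rewrite ltrDl exprn_gt0.
  by rewrite ltr_wpDl ?sqr_ge0 // exprn_gt0.
have pA := pos _ A0; have pB := pos _ B0.
(* [L] lies halfway between [A + B] and the sum of the two hypotenuses: large enough for a path of
   that length to exist, too small for a path that makes the detour. *)
pose L := (A + B + Num.sqrt (A ^+ 2 + r ^+ 2) + Num.sqrt (B ^+ 2 + r ^+ 2)) / 2.
have [s [hs ls hL]] : joined X u v L.
  by apply: (net_dist_adherent juv); rewrite /L; lra.
(* The inner product with [v - u], based at [z]; it vanishes exactly on the perpendicular when [u]
   and [v] differ. *)
pose f x := (x 0 0 - z 0 0) * (v 0 0 - u 0 0) + (x 0 1 - z 0 1) * (v 0 1 - u 0 1).
have [t /= /andP[t0 t1] hz] := zuv.
have fu : f u = - t * eucl_dist u v ^+ 2.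
  by rewrite sqr_eucl_dist /f -hz !mxE; ring.
have fv : f v = (1 - t) * eucl_dist u v ^+ 2.
  by rewrite sqr_eucl_dist /f -hz !mxE; ring.
have sq0 := sqr_ge0 (eucl_dist u v).
have [w [Xw fw]] : exists w, [/\ X w, f w = 0 &
    eucl_dist u w + eucl_dist w (last u s) <= path_length u s].
  apply: path_crosses => //; last by rewrite ls fv; nra.
    by move=> k x y; rewrite /f !mxE; ring.
  by rewrite fu; nra.
rewrite ls => hw.
have zw := hr w Xw.
have zw2 : r ^+ 2 <= eucl_dist z w ^+ 2.
  by rewrite ler_pXn2r // nnegrE ?eucl_dist_ge0 // ltW.
(* Pythagoras in the triangle [u z w]: the cross term is [2 * t * f w], which is 0 and is inserted
   to make the identity exact. *)
have uw : Num.sqrt (A ^+ 2 + r ^+ 2) <= eucl_dist u w.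
  rewrite -[leRHS]ger0_norm ?eucl_dist_ge0 // -sqrtr_sqr ler_sqrt ?sqr_ge0 //.
  rewrite -[leRHS]subr0 -(mulr0 (2 * t)) -fw.
  apply: le_trans (lerD (lexx _) zw2) _; rewrite /A !sqr_eucl_dist /f -hz !mxE.
  by rewrite le_eqVlt; apply/orP; left; apply/eqP; ring.
have wv : Num.sqrt (B ^+ 2 + r ^+ 2) <= eucl_dist w v.
  rewrite -[leRHS]ger0_norm ?eucl_dist_ge0 // -sqrtr_sqr ler_sqrt ?sqr_ge0 //.
  rewrite -[leRHS]addr0 -(mulr0 (2 * (1 - t))) -fw.
  apply: le_trans (lerD (lexx _) zw2) _; rewrite /B !sqr_eucl_dist /f -hz !mxE.
  by rewrite le_eqVlt; apply/orP; left; apply/eqP; ring.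
move: hL; rewrite /L; lra.
Qed.

(** A uniform bound of this kind makes the sets under the suprema of [ecc] and [net_diam] bounded
    above, so that these are true suprema. *)
Definition joined_within X (d : R) : Prop :=
  forall p q, X p -> X q -> joined X p q d.

Lemma net_dist_le_diam X d p q : joined_within X d -> X p -> X q ->
  net_dist X p q <= net_diam X.
Proof.
move=> h Xp Xq; apply: (@le_trans _ _ (ecc X p)).
  apply: ub_le_sup; last by exists q.
  by exists d => _ [x Xx <-]; apply: net_dist_le; exact: h.
apply: ub_le_sup; last by exists p.
exists d => _ [x Xx <-]; apply: ge_sup; first by exists (net_dist X x q), q.
by move=> _ [y Xy <-]; apply: net_dist_le; exact: h.
Qed.

Lemma net_diam_le X d : X !=set0 -> joined_within X d -> net_diam X <= d.
Proof.
move=> [p Xp] h; apply: ge_sup; first by exists (ecc X p), p.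
move=> _ [x Xx <-]; apply: ge_sup; first by exists (net_dist X x p), p.
by move=> _ [y Xy <-]; apply: net_dist_le; exact: h.
Qed.

End Paths.

(** * Finite unions of segments, the locus and its convex hull *)

Section FiniteUnions.
Context {R : realType}.
Local Notation point := 'rV[R]_2.
Implicit Types (p q x y z u v : point) (X : set point) (N : network R).
Implicit Types (S : seq (point * point)).

Lemma add_segments_cat X S S' :
  add_segments X (S ++ S') = add_segments (add_segments X S) S'.
Proof.
rewrite eqEsubset; split=> x.
  move=> [Xx|[e]]; first by left; left.
  rewrite mem_cat => /orP[eS|eS] xe; last by right; exists e.
  by left; right; exists e.
move=> [[Xx|[e eS xe]]|[e eS xe]]; first by left.
  by right; exists e; rewrite ?mem_cat ?eS.
by right; exists e; rewrite ?mem_cat ?eS ?orbT.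
Qed.

Lemma add_segments1 X e : add_segments X [:: e] = X `|` segment e.1 e.2.
Proof.
congr (X `|` _); rewrite eqEsubset; split=> x.
  by move=> [e']; rewrite inE => /eqP->.
by move=> xe; exists e; rewrite ?inE.
Qed.

Lemma add_segments_cons X e S :
  add_segments X (e :: S) = add_segments (X `|` segment e.1 e.2) S.
Proof. by rewrite -cat1s add_segments_cat add_segments1. Qed.

Lemma attached_sub X S :
  (forall e, e \in S -> X e.1 /\ X e.2) -> attached X S.
Proof.
elim: S X => //= e S IH X h; have [h1 h2] := h _ (mem_head _ _).
split=> //; apply: IH => e' he'; have [] := h e'; rewrite ?inE ?he' ?orbT //.
by move=> ? ?; split; left.
Qed.

Lemma attached_cat X S S' : attached X S -> attached (add_segments X S) S' ->
  attached X (S ++ S').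
Proof.
elim: S X => [|e S IH] X /=.
  move=> _; congr attached; rewrite eqEsubset; split=> x; last by left.
  by move=> [//|[e]].
by move=> [h1 h2 h3]; rewrite add_segments_cons => h4; split=> //; exact: IH.
Qed.

(** All points reach [p], through [X] or along the new segment, so twice the larger of the two costs
    is a bound. *)
Lemma joined_within_segment X d p q : joined_within X d -> X p ->
  exists d', joined_within (X `|` segment p q) d'.
Proof.
move=> hX Xp; pose Y := X `|` segment p q.
have toP x : Y x -> joined Y x p (Num.max d (eucl_dist p q)).
  move=> [Xx|xs].
    apply: (@joined_le _ _ _ _ d); first by rewrite le_max lexx.
    by apply: (joined_sub (X := X)); [move=> ? ?; left|exact: hX].
  apply: (@joined_le _ _ _ _ (eucl_dist x p)).
    rewrite le_max -(segment_dist xs) eucl_distC lerDl eucl_dist_ge0.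
    by rewrite orbT.
  apply: joined_segment; apply: subset_trans (@subsetUr _ _ _).
  by apply: segment_sub => //; exact: segment_left.
exists (Num.max d (eucl_dist p q) + Num.max d (eucl_dist p q)) => x y Yx Yy.
by apply: joined_trans (toP x Yx) _; apply: joined_sym; exact: toP.
Qed.

Lemma joined_within_attached X d S : joined_within X d -> attached X S ->
  exists d', joined_within (add_segments X S) d'.
Proof.
elim: S X d => [|e S IH] X d hX /=.
  move=> _; exists d; rewrite (_ : add_segments X [::] = X) //.
  by rewrite eqEsubset; split=> x; [move=> [//|[]]|left].
move=> [h1 h2 h3]; have [d' hd'] := joined_within_segment e.2 hX h1.
by rewrite add_segments_cons; exact: IH hd' h3.
Qed.

(** Closedness in the metric form that [net_dist_straight] asks for; the least of the finitely many
    radii works. *)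
Lemma add_segments_separated S z : ~ add_segments set0 S z ->
  exists2 r, 0 < r & forall x, add_segments set0 S x -> r <= eucl_dist z x.
Proof.
elim: S => [|e S IH] hz; first by exists 1 => // x [//|[]].
have [r r0 hr] : exists2 r, 0 < r &
    forall x, add_segments set0 S x -> r <= eucl_dist z x.
  apply: IH => -[//|[e' eS ze]]; apply: hz; right; exists e' => //.
  by rewrite inE eS orbT.
have [r' r0' hr'] : exists2 r, 0 < r &
    forall x, segment e.1 e.2 x -> r <= eucl_dist z x.
  apply: segment_separated => ze; apply: hz; right; exists e => //.
  by rewrite inE eqxx.
exists (Num.min r r'); first by rewrite lt_min r0.
move=> x [//|[e']]; rewrite inE => /orP[/eqP->|eS] xe; rewrite ge_min.
  by rewrite (hr' x) ?orbT.
by rewrite (hr x) //; right; exists e'.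
Qed.

Lemma locus_add_segments N : exists S, locus N = add_segments set0 S.
Proof.
pose V := enum_fset (vertices N).
(* Vertices enter as degenerate segments, which covers isolated ones. *)
exists ([seq (u, u) | u <- V] ++
        [seq e <- [seq (u, v) | u <- V, v <- V] | adj N e.1 e.2]).
rewrite eqEsubset; split=> x.
  move=> [xV|[u [v [uv xuv]]]]; right.
    exists (x, x); last exact: segment_left.
    by rewrite mem_cat map_f.
  exists (u, v) => //; rewrite mem_cat mem_filter /= uv /=.
  apply/orP; right; apply: allpairs_f; first exact: adj_vertex uv.
  by move: uv; rewrite adj_sym => uv; exact: adj_vertex uv.
move=> [//|[e]]; rewrite mem_cat => /orP[/mapP[u uV ->]|].
  by rewrite /= segmentxx => ->; left.
by rewrite mem_filter => /andP[uv _] xe; right; exists e.1, e.2.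
Qed.

Lemma locus_segment N x : locus N x ->
  exists u v, [/\ u \in vertices N, v \in vertices N & segment u v x].
Proof.
move=> [xV|[u [v [uv xuv]]]].
  by exists x, x; split=> //; exact: segment_left.
exists u, v; split=> //; first exact: adj_vertex uv.
by move: uv; rewrite adj_sym => uv; exact: adj_vertex uv.
Qed.

Lemma locus_vertex N x : x \in vertices N -> locus N x.
Proof. by left. Qed.

Lemma adj_path_joined N u s : u \in vertices N -> path (adj N) u s ->
  exists d, joined (locus N) u (last u s) d.
Proof.
elim: s u => [|v s IH] u uV /=; first by exists 0; apply: joined_refl; left.
move=> /andP[uv vs]; have vV : v \in vertices N.
  by move: uv; rewrite adj_sym => uv; exact: adj_vertex uv.
have [d hd] := IH _ vV vs; exists (eucl_dist u v + d).
by apply: joined_trans hd; apply: joined_segment => x xuv; right; exists u, v.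
Qed.

(** All paths are routed through one root [r]: finitely many vertices reach it within a common
    bound, and a point of an edge first walks to an endpoint. *)
Lemma locus_joined_within N : graph_connected N ->
  exists d, joined_within (locus N) d.
Proof.
move=> [[r rV] hN].
have [d hd] : exists d, forall u, u \in vertices N -> joined (locus N) u r d.
  suff H (s : seq point) : (forall u, u \in s -> u \in vertices N) ->
      exists d, forall u, u \in s -> joined (locus N) u r d.
    by apply: (H (enum_fset (vertices N))).
  elim: s => [|v s IH] hs; first by exists 0.
  have [d hd] : exists d, forall u, u \in s -> joined (locus N) u r d.
    by apply: IH => u us; apply: hs; rewrite inE us orbT.
  have vV := hs v (mem_head _ _); have [w ws wl] := hN v r vV rV.
  have [d' hd'] := adj_path_joined vV ws; rewrite wl in hd'.
  exists (Num.max d d') => u; rewrite inE => /orP[/eqP->|us].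
    by apply: joined_le hd'; rewrite le_max lexx orbT.
  by apply: joined_le (hd _ us); rewrite le_max lexx.
have [e he] : exists e, forall x, locus N x -> joined (locus N) x r e.
  have [M hM] : exists M, forall u v, u \in vertices N -> v \in vertices N ->
      eucl_dist u v <= M.
    exists (d + d) => u v uV vV; apply: (@joined_ge_dist _ (locus N)).
    by apply: joined_trans (hd u uV) _; apply: joined_sym; exact: hd.
  exists (M + d) => x [xV|[u [v [uv xuv]]]].
    apply: joined_le (hd x xV); rewrite lerDr.
    exact: le_trans (eucl_dist_ge0 r r) (hM r r rV rV).
  have uV := adj_vertex uv.
  have vV : v \in vertices N.
    by move: uv; rewrite adj_sym => uv; exact: adj_vertex uv.
  apply: joined_trans (hd u uV); apply: (@joined_le _ _ _ _ (eucl_dist x u)).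
    rewrite eucl_distC; have := segment_dist xuv; have := hM u v uV vV.
    have := eucl_dist_ge0 x v; lra.
  apply: joined_segment => y yx; right; exists u, v; split=> //.
  by apply: segment_sub yx => //; exact: segment_left.
exists (e + e) => x y Xx Xy.
by apply: joined_trans (he x Xx) _; apply: joined_sym; exact: he.
Qed.

Lemma segment_closed_convex X :
  (forall x y, X x -> X y -> segment x y `<=` X) -> convex_set X.
Proof.
move=> h x y l; rewrite !in_setE => Xx Xy; apply: h Xy Xx _ _.
exists (l%:num) => //=; first by rewrite ge0 le1.
by rewrite addrC.
Qed.

(** The points within [M] of every point of a set [B] form a convex set, so such a bound passes from
    [W] to the whole hull. This is applied with [B] equal to [W], then to the hull. *)
Lemma convex_hull_dist_le X (W : point -> Prop) (M : R) :
  W `<=` X ->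
  (forall x, X x -> exists u v, [/\ W u, W v & segment u v x]) ->
  (forall u v, W u -> W v -> eucl_dist u v <= M) ->
  forall x y, convex_hull X x -> convex_hull X y -> eucl_dist x y <= M.
Proof.
move=> WX XW WM.
have ball (B : set point) : (forall u z, W u -> B z -> eucl_dist u z <= M) ->
    convex_hull X `<=` [set x | forall z, B z -> eucl_dist x z <= M].
  move=> hB; apply: smallest_sub.
    apply: segment_closed_convex => x y hx hy w xyw z Bz.
    exact: segment_ball xyw (hx z Bz) (hy z Bz).
  move=> x /XW[u [v [Wu Wv xuv]]] z Bz.
  exact: segment_ball xuv (hB u z Wu Bz) (hB v z Wv Bz).
have hullW := ball W WM.
move=> x y hx hy; apply: ball hx y hy => u z Wu hz.
by rewrite eucl_distC; exact: hullW.
Qed.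

Lemma seq_argmax (T : eqType) (F : T -> R) (s : seq T) (i : T) : i \in s ->
  exists2 m : T, m \in s & forall j : T, j \in s -> F j <= F m.
Proof.
elim: s i => // a s IH i _; case: s IH => [|b s] IH.
  by exists a; rewrite ?inE // => y; rewrite inE => /eqP->.
have [x xs hx] := IH b (mem_head _ _).
have [ax|xa] := lerP (F a) (F x).
  exists x; first by rewrite inE xs orbT.
  by move=> y; rewrite inE => /orP[/eqP->//|]; exact: hx.
exists a; first exact: mem_head.
move=> y; rewrite inE => /orP[/eqP->//|/hx yx]; exact: le_trans yx (ltW xa).
Qed.

Lemma convex_hull_diam N : graph_connected N ->
  exists u v, [/\ u \in vertices N, v \in vertices N,
    eucl_diam (convex_hull (locus N)) = eucl_dist u v &
    forall u' v', u' \in vertices N -> v' \in vertices N ->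
      eucl_dist u' v' <= eucl_dist u v].
Proof.
move=> [[r rV] _]; pose V := enum_fset (vertices N).
have /(seq_argmax (fun e => eucl_dist e.1 e.2)) [[u v]] :
    (r, r) \in [seq (u, v) | u <- V, v <- V] by exact: allpairs_f.
move=> /allpairsP[[u' v'] /= [uV vV [eu ev]]] hm; subst u' v'.
have hM u' v' : u' \in vertices N -> v' \in vertices N ->
    eucl_dist u' v' <= eucl_dist u v.
  by move=> hu hv; apply: (hm (u', v')); exact: allpairs_f.
exists u, v; split=> //.
have hull_le x y : convex_hull (locus N) x -> convex_hull (locus N) y ->
    eucl_dist x y <= eucl_dist u v.
  apply: (@convex_hull_dist_le _ (fun u => u \in vertices N)) => //.
  - by move=> w wV; left.
  - exact: locus_segment.
have uvH : exists p q, [/\ convex_hull (locus N) p, convex_hull (locus N) q &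
    eucl_dist u v = eucl_dist p q].
  by exists u, v; split=> //; apply: sub_gen_smallest; left.
apply/eqP; rewrite eq_le; apply/andP; split.
  apply: ge_sup; first by exists (eucl_dist u v).
  by move=> _ [p [q [hp hq ->]]]; exact: hull_le.
apply: ub_le_sup => //.
by exists (eucl_dist u v) => _ [p [q [hp hq ->]]]; exact: hull_le.
Qed.

End FiniteUnions.

(** * Rays leaving a triangle and the hull *)

Section Rays.
Context {R : realType}.
Local Notation point := 'rV[R]_2.
Implicit Types (p q x y z u v w a b c d e r : point).

Lemma segment_line c d (i j k : R) : i <= j <= k ->
  segment (c + i *: d) (c + k *: d) (c + j *: d).
Proof.
move=> /andP[ij jk]; have [ik|ik] := eqVneq i k.
  by rewrite (_ : j = i); [exact: segment_left|lra].
have ki : 0 < k - i by rewrite subr_gt0 lt_neqAle ik (le_trans ij).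
exists ((j - i) / (k - i)).
  by rewrite /= divr_ge0 ?subr_ge0 ?(le_trans ij) //= ler_pdivrMr //; lra.
by apply: row2P; rewrite !mxE; field; rewrite gt_eqF.
Qed.

(** The arguments are the values of two affine functions at the ends of a segment; the segment meets
    the set where the first vanishes and the second is nonnegative. *)
Definition level_crossing (f g f' g' : R) : Prop :=
  exists2 t, 0 <= t <= 1 & (1 - t) * f + t * f' = 0 /\ 0 <= (1 - t) * g + t * g'.

Lemma level_crossingC f g f' g' :
  level_crossing f g f' g' -> level_crossing f' g' f g.
Proof.
move=> [t t01 [h1 h2]]; exists (1 - t); first lra.
by rewrite opprB addrCA subrr addr0 addrC h1 addrC; split.
Qed.

(** At the zero [- f / (f' - f)] of the first function the second equals
    [(g * f' - g' * f) / (f' - f)]. The other conclusion is the endpoint [t = 0]. *)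
Lemma not_level_crossing f g f' g' : ~ level_crossing f g f' g' ->
  [/\ f <= 0 -> 0 < f' -> g * f' - g' * f < 0 & f = 0 -> g < 0].
Proof.
move=> h; split=> [f0 f0'|f0]; rewrite ltNge; apply/negP => hg; apply: h.
  have d0 : 0 < f' - f by lra.
  exists (- f / (f' - f)).
    apply/andP; split; first by apply: divr_ge0; lra.
    by rewrite ler_pdivrMr //; lra.
  split; first by field; rewrite gt_eqF.
  rewrite (_ : _ + _ = (g * f' - g' * f) / (f' - f)).
    by apply: divr_ge0 => //; lra.
  by field; rewrite gt_eqF.
by exists 0; rewrite ?lexx ?ler01 //= subr0 !mul1r !mul0r !addr0.
Qed.

(** A ray that starts inside a triangle must leave it through a side. Only vertex values and
    barycentric weights enter, so the proof is a case analysis on the signs of [f1], [f2], [f3]. *)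
Lemma triangle_level_crossing (f1 f2 f3 g1 g2 g3 l1 l2 l3 : R) :
  0 <= l1 -> 0 <= l2 -> 0 <= l3 -> l1 + l2 + l3 = 1 ->
  l1 * f1 + l2 * f2 + l3 * f3 = 0 -> 0 <= l1 * g1 + l2 * g2 + l3 * g3 ->
  [\/ level_crossing f1 g1 f2 g2, level_crossing f2 g2 f3 g3 |
      level_crossing f1 g1 f3 g3].
Proof.
move=> l1p l2p l3p ls lf lg; apply: contrapT => h.
have h12 : ~ level_crossing f1 g1 f2 g2 by move=> ?; apply: h; constructor 1.
have h23 : ~ level_crossing f2 g2 f3 g3 by move=> ?; apply: h; constructor 2.
have h13 : ~ level_crossing f1 g1 f3 g3 by move=> ?; apply: h; constructor 3.
have h21 : ~ level_crossing f2 g2 f1 g1 by move/level_crossingC.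
have h32 : ~ level_crossing f3 g3 f2 g2 by move/level_crossingC.
have h31 : ~ level_crossing f3 g3 f1 g1 by move/level_crossingC.
(* Eliminating vertex [j] from the two weighted sums leaves a nonnegative combination of two
   negative cross terms. Hence [li] and [lk] vanish, all weight sits at [j], and [0 < fj]
   contradicts the zero sum. *)
have one_pos (fi fj fk gi gj gk li lj lk : R) : 0 <= li -> 0 <= lj -> 0 <= lk ->
    li + lj + lk = 1 -> li * fi + lj * fj + lk * fk = 0 ->
    0 <= li * gi + lj * gj + lk * gk ->
    ~ level_crossing fi gi fj gj -> ~ level_crossing fk gk fj gj ->
    fi <= 0 -> fk <= 0 -> 0 < fj -> False.
  move=> i0 j0 k0 s0 F0 G0 /not_level_crossing[Hi _] /not_level_crossing[Hk _].
  move=> hi hk hj; have {}Hi := Hi hi hj; have {}Hk := Hk hk hj.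
  have T : 0 <= li * (gi * fj - gj * fi) + lk * (gk * fj - gj * fk).
    rewrite (_ : _ + _ = fj * (li * gi + lj * gj + lk * gk)
      - gj * (li * fi + lj * fj + lk * fk)); last by ring.
    by rewrite F0 mulr0 subr0 mulr_ge0 // ltW.
  have li0 : li = 0 by nra.
  have lk0 : lk = 0 by nra.
  nra.
(* The same elimination puts all weight at [j]; now [fj = 0], so [gj < 0] by the endpoint
   condition. *)
have two_pos (fi fj fk gi gj gk li lj lk : R) : 0 <= li -> 0 <= lj -> 0 <= lk ->
    li + lj + lk = 1 -> li * fi + lj * fj + lk * fk = 0 ->
    0 <= li * gi + lj * gj + lk * gk ->
    ~ level_crossing fj gj fi gi -> ~ level_crossing fj gj fk gk ->
    0 < fi -> 0 < fk -> fj <= 0 -> False.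
  move=> i0 j0 k0 s0 F0 G0 /not_level_crossing[Hi Hj] /not_level_crossing[Hk _].
  move=> hi hk hj; have {}Hi := Hi hj hi; have {}Hk := Hk hj hk.
  have T : 0 <= li * (gj * fi - gi * fj) + lk * (gj * fk - gk * fj).
    rewrite (_ : _ + _ = - fj * (li * gi + lj * gj + lk * gk)
      + gj * (li * fi + lj * fj + lk * fk)); last by ring.
    by rewrite F0 mulr0 addr0 mulr_ge0 // oppr_ge0.
  have li0 : li = 0 by nra.
  have lk0 : lk = 0 by nra.
  have lj1 : lj = 1 by lra.
  subst li lk lj; have {}Hj : gj < 0 by apply: Hj; lra.
  lra.
have [n1|n1] := lerP f1 0; have [n2|n2] := lerP f2 0; have [n3|n3] := lerP f3 0.
(* With no positive value, every product of weight and value is 0, so any positive weight sits where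
   [f] vanishes and [g] is negative. *)
- have m1 := mulr_ge0_le0 l1p n1; have m2 := mulr_ge0_le0 l2p n2.
  have m3 := mulr_ge0_le0 l3p n3.
  have z1 : l1 * f1 = 0 by lra.
  have z2 : l2 * f2 = 0 by lra.
  have z3 : l3 * f3 = 0 by lra.
  have gneg (l f g : R) : 0 <= l -> l * f = 0 -> (f = 0 -> g < 0) -> l * g <= 0 /\
      (l * g = 0 -> l = 0).
    move=> l0 /eqP; rewrite mulf_eq0 => /orP[/eqP->|/eqP f0] hg.
      by rewrite mul0r lexx.
    have {}hg := hg f0; split; first by rewrite mulr_ge0_le0 // ltW.
    by move=> /eqP; rewrite mulf_eq0 (lt_eqF hg) orbF => /eqP.
  have [_ G1] := not_level_crossing h12; have [_ G2] := not_level_crossing h23.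
  have [_ G3] := not_level_crossing h31.
  have [a1 b1] := gneg _ _ _ l1p z1 G1; have [a2 b2] := gneg _ _ _ l2p z2 G2.
  have [a3 b3] := gneg _ _ _ l3p z3 G3.
  have e1 : l1 = 0 by apply: b1; lra.
  have e2 : l2 = 0 by apply: b2; lra.
  have e3 : l3 = 0 by apply: b3; lra.
  lra.
- by apply: (one_pos f1 f3 f2 g1 g3 g2 l1 l3 l2) => //; lra.
- by apply: (one_pos f1 f2 f3 g1 g2 g3 l1 l2 l3) => //; lra.
- by apply: (two_pos f2 f1 f3 g2 g1 g3 l2 l1 l3) => //; lra.
- by apply: (one_pos f2 f1 f3 g2 g1 g3 l2 l1 l3) => //; lra.
- by apply: (two_pos f1 f2 f3 g1 g2 g3 l1 l2 l3) => //; lra.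
- by apply: (two_pos f1 f3 f2 g1 g3 g2 l1 l3 l2) => //; lra.
- have m1 := mulr_ge0 l1p (ltW n1); have m2 := mulr_ge0 l2p (ltW n2).
  have m3 := mulr_ge0 l3p (ltW n3).
  have zero (l f : R) : 0 < f -> l * f = 0 -> l = 0.
    by move=> f0 /eqP; rewrite mulf_eq0 (gt_eqF f0) orbF => /eqP.
  have e1 : l1 = 0 by apply: zero n1 _; lra.
  have e2 : l2 = 0 by apply: zero n2 _; lra.
  have e3 : l3 = 0 by apply: zero n3 _; lra.
  lra.
Qed.

(** A point of the triangle [u v w] is given through a point [a] of the side [u v]; the two
    parameters yield its barycentric weights. *)
Lemma triangle_ray (f g : point -> R) u v w a p :
  (forall t x y, f ((1 - t) *: x + t *: y) = (1 - t) * f x + t * f y) ->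
  (forall t x y, g ((1 - t) *: x + t *: y) = (1 - t) * g x + t * g y) ->
  segment u v a -> segment a w p -> f p = 0 -> 0 <= g p ->
  exists x y e, [/\ (x, y) \in [:: (u, v); (v, w); (u, w)],
    segment x y e, f e = 0 & 0 <= g e].
Proof.
move=> hf hg [s /= /andP[s0 s1] <-] [t /= /andP[t0 t1] <-].
rewrite !hf !hg => fp gp.
have [||||||[k k01 [h1 h2]]|[k k01 [h1 h2]]|[k k01 [h1 h2]]] :=
    @triangle_level_crossing (f u) (f v) (f w) (g u) (g v) (g w)
      ((1 - t) * (1 - s)) ((1 - t) * s) t.
- by apply: mulr_ge0; lra.
- by apply: mulr_ge0; lra.
- by [].
- by ring.
- by rewrite -fp; ring.
- by move: gp; congr (_ <= _); ring.
- exists u, v, ((1 - k) *: u + k *: v); rewrite hf hg !inE eqxx.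
  by split=> //; exact: segment_conv.
- exists v, w, ((1 - k) *: v + k *: w); rewrite hf hg !inE eqxx orbT.
  by split=> //; exact: segment_conv.
- exists u, w, ((1 - k) *: u + k *: w); rewrite hf hg !inE eqxx !orbT.
  by split=> //; exact: segment_conv.
Qed.

(* The ray from [c] through [p] is cut out by [f = 0 <= g]. It leaves the
   triangle [a, u2, v2] through [u2 v2], or through a side at [a], which lies
   in the triangle [u1, v1, u2] or [u1, v1, v2]. *)
Lemma ray_hits_segment (W : set point) u1 v1 u2 v2 a b p c :
  W u1 -> W v1 -> W u2 -> W v2 ->
  segment u1 v1 a -> segment u2 v2 b -> segment a b p ->
  exists u v e, [/\ W u, W v, segment u v e & segment c e p].
Proof.
move=> Wu1 Wv1 Wu2 Wv2 ha hb hp.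
have [->|pc] := eqVneq p c.
  by exists u1, u1, u1; split=> //; exact: segment_left.
(* [f] vanishes on the line [cp], and [g] below is nonnegative on the side of [p] away from [c], so
   the exit point [e] has [p] between [c] and itself. *)
pose f z := (p 0 0 - c 0 0) * (z 0 1 - p 0 1) - (p 0 1 - c 0 1) * (z 0 0 - p 0 0).
pose g z := (p 0 0 - c 0 0) * (z 0 0 - p 0 0) + (p 0 1 - c 0 1) * (z 0 1 - p 0 1).
have hf t x y : f ((1 - t) *: x + t *: y) = (1 - t) * f x + t * f y.
  by rewrite /f !mxE; ring.
have hg t x y : g ((1 - t) *: x + t *: y) = (1 - t) * g x + t * g y.
  by rewrite /g !mxE; ring.
have fp : f p = 0 by rewrite /f; ring.
have gp : 0 <= g p by rewrite /g !subrr !mulr0 addr0.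
have [u [v [e [Wu Wv he fe ge]]]] :
    exists u v e, [/\ W u, W v, segment u v e, f e = 0 & 0 <= g e].
  rewrite segmentC in hp.
  have [x [y [e [exy he fe ge]]]] := triangle_ray hf hg hb hp fp gp.
  have last2 w : W w -> segment a w e ->
      exists u v e, [/\ W u, W v, segment u v e, f e = 0 & 0 <= g e].
    move=> Ww hw; have [x' [y' [e' [exy' he' fe' ge']]]] :=
      triangle_ray hf hg ha hw fe ge.
    exists x', y', e'; split=> //;
    by move: exy'; rewrite !inE => /or3P[] /eqP[ex' ey']; rewrite ?ex' ?ey'.
  move: exy; rewrite !inE => /or3P[] /eqP[ex ey]; subst x y.
  - by exists u2, v2, e.
  - by apply: (last2 v2); rewrite // segmentC.
  - by apply: (last2 u2); rewrite // segmentC.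
exists u, v, e; split=> //.
pose D := (p 0 0 - c 0 0) ^+ 2 + (p 0 1 - c 0 1) ^+ 2.
have D0 : 0 < D.
  rewrite lt_neqAle addr_ge0 ?sqr_ge0 // andbT eq_sym.
  rewrite paddr_eq0 ?sqr_ge0 // !sqrf_eq0 !subr_eq0.
  by apply: contra pc => /andP[/eqP h0 /eqP h1]; apply/eqP; exact: row2P.
have Dn0 : D != 0 by rewrite gt_eqF.
have -> : e = c + (1 + g e / D) *: (p - c).
  apply: row2P; rewrite !mxE; apply: (mulfI Dn0).
    transitivity (D * c 0 0 + (D + g e) * (p 0 0 - c 0 0)
                  - (p 0 1 - c 0 1) * f e); first by rewrite /D /g /f; ring.
    by rewrite fe; field.
  transitivity (D * c 0 1 + (D + g e) * (p 0 1 - c 0 1)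
                + (p 0 0 - c 0 0) * f e); first by rewrite /D /g /f; ring.
  by rewrite fe; field.
rewrite -{1}[c]addr0 -[X in segment (_ + X) _ _](scale0r (p - c)).
rewrite [X in segment _ _ X](_ : p = c + 1 *: (p - c)); last first.
  by rewrite scale1r addrC subrK.
by apply: segment_line; rewrite ler01 lerDl divr_ge0 // ltW.
Qed.

(** The order on the line is [e'], [p], [q], [e]. Eliminating [q] from the two convex combinations
    writes [p] as one of [e] and [e'], with denominator [1 - (1 - s) * (1 - t)]. *)
Lemma opposite_rays p q e e' : p <> q -> segment p e q -> segment q e' p ->
  eucl_dist e e' = eucl_dist e p + eucl_dist p e'.
Proof.
move=> pq [t /= /andP[t0 t1] hq] [s /= /andP[s0 s1] hp].
apply/esym/segment_dist.
have tp : 0 < t.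
  rewrite lt_neqAle t0 andbT eq_sym; apply/eqP => t00; apply: pq.
  by rewrite -hq t00 subr0 scale1r scale0r addr0.
have D0 : 0 < s + t - s * t by nra.
exists (s / (s + t - s * t)).
  rewrite /= divr_ge0 ?(ltW D0) //= ler_pdivrMr // mul1r.
  by rewrite -subr_ge0 (_ : _ - _ = t * (1 - s)) ?mulr_ge0 ?subr_ge0 //; ring.
have hi i : (s + t - s * t) * p 0 i = t * (1 - s) * e 0 i + s * e' 0 i.
  have := congr1 (fun z : point => z 0 i) hp.
  have := congr1 (fun z : point => z 0 i) hq.
  rewrite !mxE => <- h.
  rewrite -[s * e' 0 i](addrK ((1 - s) * ((1 - t) * p 0 i + t * e 0 i))).
  by rewrite [s * e' 0 i + _]addrC h; ring.
apply: row2P; rewrite !mxE; apply: (mulfI (lt0r_neq0 D0)); rewrite hi; field;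
  exact: lt0r_neq0.
Qed.

End Rays.


(** * Leaving a thin triangle at small extra cost *)

Section ThinTriangles.
Context {R : realType}.
Local Notation point := 'rV[R]_2.
Implicit Types (p q x y z u v w a b c d e r : point).

(** This is the degenerate triangle. The projection parameter [k] locates [c] on the line [r r'],
    and comparing it with the parameter [w] of [e] decides the side. *)
Lemma collinear_segments c r r' e :
  (r 0 0 - c 0 0) * (r' 0 1 - c 0 1) - (r 0 1 - c 0 1) * (r' 0 0 - c 0 0) = 0 ->
  segment r r' e -> segment c r e \/ segment c r' e.
Proof.
move=> hc; have [->|rr] := eqVneq r r'.
  by rewrite segmentxx => ->; left; exact: segment_right.
move=> [w /= /andP[w0 w1] he].
pose D := (r' 0 0 - r 0 0) ^+ 2 + (r' 0 1 - r 0 1) ^+ 2.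
have D0 : D != 0.
  rewrite paddr_eq0 ?sqr_ge0 // !sqrf_eq0 !subr_eq0 ![r' _ _ == _]eq_sym.
  by apply: contra rr => /andP[/eqP h0 /eqP h1]; apply/eqP; exact: row2P.
pose k := ((c 0 0 - r 0 0) * (r' 0 0 - r 0 0)
           + (c 0 1 - r 0 1) * (r' 0 1 - r 0 1)) / D.
have ec : c = r + k *: (r' - r).
  apply: row2P; rewrite !mxE; apply: (mulfI D0); apply/eqP; rewrite -subr_eq0.
    apply/eqP; transitivity (- (r' 0 1 - r 0 1) *
      ((r 0 0 - c 0 0) * (r' 0 1 - c 0 1) - (r 0 1 - c 0 1) * (r' 0 0 - c 0 0))).
      rewrite mulrDr /k [_ * (_ / D * _)]mulrA [D * (_ / D)]mulrC divfK //.
      by rewrite /D; ring.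
    by rewrite hc mulr0.
  apply/eqP; transitivity ((r' 0 0 - r 0 0) *
    ((r 0 0 - c 0 0) * (r' 0 1 - c 0 1) - (r 0 1 - c 0 1) * (r' 0 0 - c 0 0))).
    rewrite mulrDr /k [_ * (_ / D * _)]mulrA [D * (_ / D)]mulrC divfK //.
    by rewrite /D; ring.
  by rewrite hc mulr0.
have ee : e = r + w *: (r' - r) by rewrite -he; apply: row2P; rewrite !mxE; ring.
have er' : r' = r + 1 *: (r' - r) by rewrite scale1r addrC subrK.
have er : r = r + 0 *: (r' - r) by rewrite scale0r addr0.
have line (i j k : R) := @segment_line _ r (r' - r) i j k.
have [kw|wk] := lerP k w.
  by right; have := line k w 1; rewrite -ec -ee -er' kw; apply.
by left; have := line 0 w k; rewrite -ec -ee -er w0 ltW // segmentC; apply.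
Qed.

(** Moving from [(B, C)] towards [(B', C')], stop at the first zero of a coordinate that ends
    negative, or at the end. *)
Lemma clip_nonneg (B C B' C' : R) : 0 <= B -> 0 <= C ->
  exists t, [/\ 0 <= t <= 1, 0 <= (1 - t) * B + t * B', 0 <= (1 - t) * C + t * C' &
    [\/ t = 1, (1 - t) * B + t * B' = 0 | (1 - t) * C + t * C' = 0]].
Proof.
move=> B0 C0.
have zero (A A' : R) : 0 <= A -> A' < 0 ->
    exists2 t, 0 <= t <= 1 & (1 - t) * A + t * A' = 0.
  move=> A0 A'0; have d0 : 0 < A - A' by lra.
  exists (A / (A - A')); last by field; rewrite gt_eqF.
  by rewrite divr_ge0 ?(ltW d0) //= ler_pdivrMr // mul1r; lra.
have [B'0|B'0] := lerP 0 B'; have [C'0|C'0] := lerP 0 C'.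
- exists 1; rewrite subrr !mul0r !mul1r !add0r lexx ler01.
  by split=> //; constructor 1.
- have [t t01 ht] := zero C C' C0 C'0; exists t; rewrite ht lexx.
  by split=> //; [nra|constructor 3].
- have [t t01 ht] := zero B B' B0 B'0; exists t; rewrite ht lexx.
  by split=> //; [nra|constructor 2].
have [t t01 ht] := zero C C' C0 C'0; have [s s01 hs] := zero B B' B0 B'0.
have [st|ts] := lerP s t.
  exists s; rewrite hs lexx; split=> //; last by constructor 2.
  have : 0 <= (t - s) * (C - C') by rewrite mulr_ge0 ?subr_ge0 //; lra.
  nra.
exists t; rewrite ht lexx; split=> //; last by constructor 3.
have : 0 <= (s - t) * (B - B') by rewrite mulr_ge0 ?subr_ge0 //; [exact: ltW|lra].
nra.
Qed.

(** From [p], follow [ab] in a direction that does not recede from [c] in barycentric level, until a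
    side at [c] or an end of [ab] is reached. The stopping point is within [|rr'|] of the segment
    [cp], which costs at most that much on each leg. *)
Lemma thin_triangle_exit c r r' e p a b :
  segment r r' e -> segment c e p -> segment a b p ->
  exists x, [/\ segment a b x,
    segment c r x \/ segment c r' x \/ x \in [:: a; b] &
    eucl_dist p x + eucl_dist x c <= eucl_dist p c + 2 * eucl_dist r r'].
Proof.
move=> he hp pab.
pose K := (r 0 0 - c 0 0) * (r' 0 1 - c 0 1) - (r 0 1 - c 0 1) * (r' 0 0 - c 0 0).
have [K0|K0] := eqVneq K 0.
  exists p; rewrite eucl_distxx add0r lerDl mulr_ge0 ?eucl_dist_ge0 //.
  have sub z : segment c z e -> segment c z p.
    by move=> hz; apply: (@segment_sub _ c z c e) => //; exact: segment_left.
  by split=> //; have [h|h] := collinear_segments K0 he;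
    [left|right; left]; apply: sub.
have [w /= /andP[w0 w1] ew] := he; have [t /= /andP[t0 t1] et] := hp.
(* Barycentric coordinates of [r] and [r'] in the triangle [c r r']. Their sum, the level, is 0 at
   [c], 1 on [r r'] and [t] at [p]. *)
pose beta z := ((z 0 0 - c 0 0) * (r' 0 1 - c 0 1)
                - (z 0 1 - c 0 1) * (r' 0 0 - c 0 0)) / K.
pose gamma z := ((r 0 0 - c 0 0) * (z 0 1 - c 0 1)
                 - (r 0 1 - c 0 1) * (z 0 0 - c 0 0)) / K.
have bary z : z = c + (beta z *: (r - c) + gamma z *: (r' - c)).
  apply: row2P; rewrite !mxE; apply: (mulfI K0);
  rewrite mulrDr mulrDr [K * (beta z * _)]mulrA [K * (gamma z * _)]mulrA
    [K * beta z]mulrC [K * gamma z]mulrC !divfK // /K; ring.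
have bconv s x y : beta ((1 - s) *: x + s *: y) = (1 - s) * beta x + s * beta y.
  by rewrite /beta !mxE; field.
have gconv s x y : gamma ((1 - s) *: x + s *: y) = (1 - s) * gamma x + s * gamma y.
  by rewrite /gamma !mxE; field.
have bc : beta c = 0 by rewrite /beta; field.
have gc : gamma c = 0 by rewrite /gamma; field.
have br : beta r = 1 by rewrite /beta -/K; exact: divff.
have gr : gamma r = 0 by rewrite /gamma; field.
have br' : beta r' = 0 by rewrite /beta; field.
have gr' : gamma r' = 1 by rewrite /gamma -/K; exact: divff.
have be : beta e = 1 - w by rewrite -ew bconv br br'; ring.
have ge : gamma e = w by rewrite -ew gconv gr gr'; ring.
have bp : beta p = t * (1 - w) by rewrite -et bconv bc be; ring.
have gp : gamma p = t * w by rewrite -et gconv gc ge; ring.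
have exit a' : segment a b a' -> a' \in [:: a; b] -> beta a' + gamma a' <= t ->
    exists x, [/\ segment a b x,
      segment c r x \/ segment c r' x \/ x \in [:: a; b] &
      eucl_dist p x + eucl_dist x c <= eucl_dist p c + 2 * eucl_dist r r'].
  move=> aab a'ab sa.
  have bp0 : 0 <= beta p by rewrite bp; apply: mulr_ge0; lra.
  have gp0 : 0 <= gamma p by rewrite gp; apply: mulr_ge0; lra.
  have [k [k01 kb kg kz]] := clip_nonneg (beta a') (gamma a') bp0 gp0.
  pose x := (1 - k) *: p + k *: a'.
  rewrite -!bconv -!gconv -/x in kb kg kz.
  have sx : beta x + gamma x <= t.
    rewrite /x bconv gconv bp gp.
    rewrite (_ : _ + _ = (1 - k) * t + k * (beta a' + gamma a')); last by ring.
    nra.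
  exists x; split.
  - by apply: (segment_sub pab aab); exact: segment_conv.
  - case: kz => [k1|bx|gx].
    + by right; right; rewrite /x k1 subrr scale0r add0r scale1r.
    + right; left; exists (gamma x); first by rewrite /=; lra.
      by rewrite [RHS]bary bx; apply: row2P; rewrite !mxE; ring.
    + left; exists (beta x); first by rewrite /=; lra.
      by rewrite [RHS]bary gx; apply: row2P; rewrite !mxE; ring.
  (* The point of [ce] at the level of [x]; this level is at most [t], so [x'] lies between [c] and
     [p]. *)
  pose x' := c + (beta x + gamma x) *: (e - c).
  have xx' : eucl_dist x x' <= eucl_dist r r'.
    rewrite [x in eucl_dist x]bary /x' scalerDl eucl_distDl.
    apply: le_trans (eucl_dist_triangle
      (beta x *: (e - c) + gamma x *: (r' - c)) _ _) _.
    rewrite eucl_distDr eucl_distDl !eucl_distZ !eucl_distDr !ger0_norm //.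
    rewrite [eucl_dist r' e]eucl_distC; have := segment_dist he.
    have := eucl_dist_ge0 r e; have := eucl_dist_ge0 e r'.
    by move=> h1 h2 h3; nra.
  have cx'p : segment c p x'.
    rewrite -[X in segment X]addr0 -[X in segment (_ + X)](scale0r (e - c)).
    rewrite [p](_ : _ = c + t *: (e - c)); last first.
      by rewrite -et; apply: row2P; rewrite !mxE; ring.
    by apply: segment_line; rewrite sx addr_ge0.
  have := segment_dist cx'p; rewrite ![eucl_dist c _]eucl_distC.
  have := eucl_dist_triangle x' p x; have := eucl_dist_triangle x' x c.
  rewrite [eucl_dist x' x]eucl_distC [eucl_dist x' p]eucl_distC; lra.
(* The level of [p] is a convex combination of those of [a] and [b], so one of the ends has level at
   most [t]. *)
have [/exit|ha] := lerP (beta a + gamma a) t.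
  by apply; [exact: segment_left|exact: mem_head].
have [/exit|hb] := lerP (beta b + gamma b) t.
  by apply; [exact: segment_right|rewrite !inE eqxx orbT].
have [k /= /andP[k0 k1] ek] := pab.
have : beta p + gamma p = (1 - k) * (beta a + gamma a) + k * (beta b + gamma b).
  by rewrite -ek bconv gconv; ring.
rewrite bp gp => h; exfalso; have [k00|kn0] := eqVneq k 0.
  by rewrite k00 in h; lra.
have m1 : 0 <= (1 - k) * (beta a + gamma a - t) by apply: mulr_ge0; lra.
have m2 : 0 < k * (beta b + gamma b - t).
  by rewrite mulr_gt0 ?subr_gt0 // lt_neqAle eq_sym kn0.
lra.
Qed.

End ThinTriangles.

(** * The complete network on the subdivision points *)

Section CompleteNetwork.
Context {R : realType}.
Local Notation point := 'rV[R]_2.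
Implicit Types (p q x y z u v w a b c d e r : point).

(** The exit point lies on [cr] or [cr'], or is an end of [ab]; in each case a segment of the
    network leads straight on to [c]. *)
Lemma fan_joined (Z P : set point) c r r' e p a b :
  (forall x y, P x -> P y -> segment x y `<=` Z) ->
  P a -> P b -> P c -> P r -> P r' ->
  segment r r' e -> segment c e p -> segment a b p ->
  joined Z p c (eucl_dist p c + 2 * eucl_dist r r').
Proof.
move=> PZ Pa Pb Pc Pr Pr' he hp pab.
have [x [xab xc xle]] := thin_triangle_exit he hp pab.
apply: joined_le xle _; apply: (@joined_trans _ _ _ x).
  by apply: joined_segment; apply: subset_trans (segment_sub pab xab) (PZ _ _ Pa Pb).
apply: joined_segment.
have sub y : P y -> segment c y x -> segment x c `<=` Z.
  move=> Py xcy; apply: subset_trans (PZ _ _ Pc Py).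
  by apply: segment_sub => //; exact: segment_left.
case: xc => [|[|]]; [exact: sub|exact: sub|].
by rewrite !inE => /orP[] /eqP->; exact: PZ.
Qed.

(** All pairs from [V] are subdivided, since a ray may leave the hull through any of these segments;
    [k] runs from 0 to [n], so both ends are included. *)
Definition subdivision (V : seq point) (n : nat) : seq point :=
  [seq (1 - ke.1%:R / n%:R) *: ke.2.1 + (ke.1%:R / n%:R) *: ke.2.2
  | ke <- [seq (k, uv) | k <- iota 0 n.+1, uv <- [seq (u, v) | u <- V, v <- V]]].

Lemma subdivisionP V n x : (0 < n)%N -> x \in subdivision V n ->
  exists u v, [/\ u \in V, v \in V & segment u v x].
Proof.
move=> n0 /mapP[_ /allpairsP[[k _] /= [kn /allpairsP[[u v] /= [uV vV ->]] ->]] ->].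
exists u, v; split=> //; apply: segment_conv.
rewrite divr_ge0 ?ler0n //= ler_pdivrMr ?ltr0n // mul1r ler_nat.
by move: kn; rewrite inE mem_iota => /orP[/eqP->//|/andP[_]].
Qed.

Lemma mem_subdivision V n u v (k : nat) : u \in V -> v \in V -> (k <= n)%N ->
  (1 - k%:R / n%:R) *: u + (k%:R / n%:R) *: v \in subdivision V n.
Proof.
move=> uV vV kn; apply/mapP; exists (k, (u, v)) => //.
by apply: allpairs_f; [rewrite mem_iota|exact: allpairs_f].
Qed.

Lemma sub_subdivision V n u : u \in V -> u \in subdivision V n.
Proof.
by move=> uV; have := mem_subdivision uV uV (leq0n n); rewrite scale_onemxx.
Qed.

Lemma subdivision_fine V n u v e (h : R) : (0 < n)%N -> u \in V -> v \in V ->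
  eucl_dist u v <= h -> segment u v e ->
  exists r r', [/\ r \in subdivision V n, r' \in subdivision V n,
    segment r r' e & eucl_dist r r' <= h / n%:R].
Proof.
move=> n0 uV vV uvh [w /= /andP[w0 w1] ew].
have h0 : 0 <= h := le_trans (eucl_dist_ge0 u v) uvh.
have nR : 0 < n%:R :> R by rewrite ltr0n.
(* For [w = 1] the index [k] below would be [n], and its successor out of range. *)
have [w1'|w1'] := eqVneq w 1.
  exists v, v; rewrite !sub_subdivision // eucl_distxx divr_ge0 ?ler0n //.
  by split=> //; rewrite -ew w1' subrr scale0r add0r scale1r; exact: segment_left.
pose k := Num.truncn (w * n%:R).
have /andP[k1 k2] : k%:R <= w * n%:R < k.+1%:R.
  by apply: truncn_itv; rewrite mulr_ge0 // ler0n.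
have wn : w * n%:R < n%:R by rewrite gtr_pMl // lt_neqAle w1'.
have kn : (k < n)%N by rewrite -(ltr_nat R) (le_lt_trans k1).
pose pt (t : R) := (1 - t) *: u + t *: v.
have ptE t : pt t = u + t *: (v - u) by apply: row2P; rewrite !mxE; ring.
exists (pt (k%:R / n%:R)), (pt (k.+1%:R / n%:R)); split.
- by apply: mem_subdivision => //; exact: ltnW.
- exact: mem_subdivision.
- rewrite -ew -/(pt w) !ptE; apply: segment_line.
  by rewrite ler_pdivrMr // k1 ler_pdivlMr // ltW.
rewrite !ptE eucl_distDl.
rewrite (_ : k.+1%:R / n%:R *: (v - u) = k%:R / n%:R *: (v - u) + n%:R^-1 *: (v - u)).
  rewrite -[X in eucl_dist X _]addr0 eucl_distDl -(scaler0 _ n%:R^-1) eucl_distZ.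
  rewrite -(eucl_distDr _ _ u) add0r subrK ger0_norm ?invr_ge0 ?ler0n // mulrC.
  by rewrite ler_pM2r // invr_gt0.
by rewrite -scalerDl -natr1 mulrDl mul1r.
Qed.

(* For distinct [p] and [q], the line [pq] leaves the hull at two points [e]
   and [e'], and the detours through them have total length [2 * |ee'|], so
   that one of them is at most [h]. *)
Lemma complete_network_joined (V : seq point) (n : nat) (h : R) (Z : set point) :
  (0 < n)%N ->
  (forall u v, u \in V -> v \in V -> eucl_dist u v <= h) ->
  (forall a b, a \in subdivision V n -> b \in subdivision V n ->
    segment a b `<=` Z) ->
  (forall p, Z p -> exists a b, [/\ a \in subdivision V n,
    b \in subdivision V n & segment a b p]) ->
  joined_within Z (h + 6 * (h / n%:R)).
Proof.
move=> n0 Vh PZ ZP p q Zp Zq.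
have [a [b [aP bP pab]]] := ZP p Zp; have [a' [b' [aP' bP' qab]]] := ZP q Zq.
have h0 : 0 <= h.
  have [u [v [uV vV _]]] := subdivisionP n0 aP.
  exact: le_trans (eucl_dist_ge0 u v) (Vh u v uV vV).
have hn0 : 0 <= h / n%:R by rewrite divr_ge0 ?ler0n.
have ray x y c : x \in subdivision V n -> y \in subdivision V n ->
    forall z, segment x y z ->
    exists u v e, [/\ u \in V, v \in V, segment u v e & segment c e z].
  move=> xP yP z xyz; have [u1 [v1 [uV1 vV1 h1]]] := subdivisionP n0 xP.
  have [u2 [v2 [uV2 vV2 h2]]] := subdivisionP n0 yP.
  exact: (@ray_hits_segment _ [set u | u \in V] u1 v1 u2 v2 x y z c).
have near x y z c : x \in subdivision V n -> y \in subdivision V n ->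
    segment x y z -> c \in subdivision V n ->
    joined Z z c (eucl_dist z c + 2 * (h / n%:R)).
  move=> xP yP xyz cP; have [u [v [e [uV vV uve cez]]]] := ray x y c xP yP z xyz.
  have [r [r' [rP rP' rre rr]]] := subdivision_fine n0 uV vV (Vh u v uV vV) uve.
  apply: joined_le (@fan_joined Z [set x | x \in subdivision V n] c r r' e z x y
    _ _ _ _ _ _ _ _ _) => //.
  by rewrite lerD2l ler_pM2l.
(* The constant 6: each of the two legs costs [2 * (h / n%:R)] in the fan, plus [h / n%:R] for
   replacing [c] by the subdivision point [r]. *)
have via u v c : u \in V -> v \in V -> segment u v c ->
    eucl_dist p c + eucl_dist c q <= h -> joined Z p q (h + 6 * (h / n%:R)).
  move=> uV vV uvc hc.
  have [r [r' [rP rP' rrc rr]]] := subdivision_fine n0 uV vV (Vh u v uV vV) uvc.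
  have jp := near a b p r aP bP pab rP.
  have jq := joined_sym (near a' b' q r aP' bP' qab rP).
  apply: joined_le (joined_trans jp jq).
  have := segment_dist rrc; have := eucl_dist_ge0 c r'.
  have := eucl_dist_triangle c p r; have := eucl_dist_triangle c q r.
  rewrite [eucl_dist c r]eucl_distC [eucl_dist q c]eucl_distC; lra.
have [pq|/eqP pq] := eqVneq p q.
  by rewrite -pq; apply: joined_le (joined_refl Zp); lra.
(* [e] lies at or past [q] on the ray from [p], and [e'] at or past [p] on the ray from [q]. *)
have [u [v [e [uV vV uve peq]]]] := ray a' b' p aP' bP' q qab.
have [u' [v' [e' [uV' vV' uve' qep]]]] := ray a b q aP bP p pab.
have ee' : eucl_dist e e' <= h.
  have ball z : z \in V -> eucl_dist e z <= h.
    by move=> zV; apply: segment_ball uve _ _; exact: Vh.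
  by rewrite eucl_distC; apply: (segment_ball uve'); rewrite eucl_distC ball.
have lin := opposite_rays pq peq qep.
have dp := segment_dist peq; have dq := segment_dist qep.
rewrite [eucl_dist e p]eucl_distC in lin; rewrite [eucl_dist q p]eucl_distC in dq.
have [he|he] := lerP (eucl_dist p e + eucl_dist e q) h; first exact: (via u v e).
apply: (via u' v' e') => //.
rewrite [eucl_dist e q]eucl_distC in he; rewrite [eucl_dist e' q]eucl_distC; lra.
Qed.

End CompleteNetwork.

(** * The implications between the three statements *)

Section Shortcuts.
Context {R : realType}.
Implicit Type N : network R.

Lemma locus_net_dist_ge N u v : graph_connected N ->
  u \in vertices N -> v \in vertices N ->
  eucl_dist u v <= net_dist (locus N) u v.
Proof.
move=> cN uV vV; have [d hd] := locus_joined_within cN.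
by apply: (@net_dist_ge _ _ _ _ d); apply: hd; exact: locus_vertex.
Qed.

(** Attached segments keep the network uniformly joined, so its new diameter is a true supremum and
    bounds the Euclidean distance of the extremal vertices. *)
Lemma shortcut_set_hull_diam N S : graph_connected N ->
  shortcut_set (locus N) S ->
  eucl_diam (convex_hull (locus N)) < net_diam (locus N).
Proof.
move=> cN [aS dS]; have [u [v [uV vV -> _]]] := convex_hull_diam cN.
apply: le_lt_trans dS; have [d hd] := locus_joined_within cN.
have [d' hd'] := joined_within_attached hd aS.
have Yu : add_segments (locus N) S u by left; exact: locus_vertex.
have Yv : add_segments (locus N) S v by left; exact: locus_vertex.
exact: le_trans (net_dist_ge (hd' u v Yu Yv)) (net_dist_le_diam hd' Yu Yv).
Qed.

Lemma hull_diam_shortcut_set N : graph_connected N ->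
  eucl_diam (convex_hull (locus N)) < net_diam (locus N) ->
  exists S, shortcut_set (locus N) S.
Proof.
move=> cN; have [u [v [uV vV -> hM]]] := convex_hull_diam cN => lt.
set h := eucl_dist u v in hM lt.
pose V := enum_fset (vertices N).
have [n n0 hn] : exists2 n : nat, (0 < n)%N & h + 6 * (h / n%:R) < net_diam (locus N).
  have e0 : 0 < net_diam (locus N) - h by lra.
  (* Any [n] above [6 * h] divided by the gap makes the error smaller than the gap. *)
  exists (Num.truncn (6 * h / (net_diam (locus N) - h))).+1 => //.
  rewrite -ltrBrDl mulrA ltr_pdivrMr ?ltr0n // [ltRHS]mulrC -ltr_pdivrMr //.
  exact: truncnS_gt.
pose P := subdivision V n.
(* The segments of [S1] come first, so that the endpoints of those in [S2] already lie on the
   network. *)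
pose S1 := [seq (a, b) | a <- V, b <- V]; pose S2 := [seq (a, b) | a <- P, b <- P].
exists (S1 ++ S2); split.
  apply: attached_cat; apply: attached_sub => e /allpairsP[[a b] /= [aV bV ->]] /=.
    by split; exact: locus_vertex.
  by split; right; [have [x [y [xV yV xy]]] := subdivisionP n0 aV|
    have [x [y [xV yV xy]]] := subdivisionP n0 bV];
    exists (x, y) => //; exact: allpairs_f.
apply: le_lt_trans hn; apply: net_diam_le.
  by exists u; left; exact: locus_vertex.
apply: (@complete_network_joined _ V n h) => //.
  move=> a b aP bP x xab; right; exists (a, b) => //.
  by rewrite mem_cat (allpairs_f _ aP bP) orbT.
move=> p [/locus_segment[x [y [xV yV xyp]]]|[e]].
  by exists x, y; split=> //; exact: sub_subdivision.
rewrite mem_cat => /orP[] /allpairsP[[a b] /= [aV bV ->]] abp; exists a, b.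
  by split=> //; exact: sub_subdivision.
by split.
Qed.

Lemma hull_diam_not_straight N u v : graph_connected N ->
  eucl_diam (convex_hull (locus N)) < net_diam (locus N) ->
  u \in vertices N -> v \in vertices N -> diametral (locus N) u v ->
  ~ (segment u v `<=` locus N).
Proof.
move=> cN; have [u' [v' [_ _ -> hM]]] := convex_hull_diam cN => lt uV vV.
move=> [_ _ duv] /joined_segment/net_dist_le; rewrite duv.
by apply/negP; rewrite -ltNge (le_lt_trans (hM u v uV vV)).
Qed.

Lemma not_straight_hull_diam N : graph_connected N ->
  (forall u v, u \in vertices N -> v \in vertices N ->
    diametral (locus N) u v -> ~ (segment u v `<=` locus N)) ->
  eucl_diam (convex_hull (locus N)) < net_diam (locus N).
Proof.
move=> cN hns; have [u [v [uV vV -> _]]] := convex_hull_diam cN.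
have [d hd] := locus_joined_within cN.
have Xu := locus_vertex uV; have Xv := locus_vertex vV.
rewrite ltNge; apply/negP => le_uv.
have ge_uv := locus_net_dist_ge cN uV vV.
have le_diam := net_dist_le_diam hd Xu Xv.
(* The chain [|uv| <= net_dist <= net_diam <= |uv|] collapses, which makes [u] and [v] diametral. *)
apply: (hns u v uV vV); first by split=> //; lra.
apply: net_dist_straight (hd u v Xu Xv) _; last by lra.
by have [S ->] := locus_add_segments N; move=> z; exact: add_segments_separated.
Qed.

End Shortcuts.

Theorem theorem1 (R : realType) (N : network R)
    (hplane : plane N) (hconn : graph_connected N) :
  ((exists S, shortcut_set (locus N) S) <->
   (forall u v, u \in vertices N -> v \in vertices N ->
      diametral (locus N) u v -> ~ (segment u v `<=` locus N))) /\
  ((forall u v, u \in vertices N -> v \in vertices N ->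
      diametral (locus N) u v -> ~ (segment u v `<=` locus N)) <->
   eucl_diam (convex_hull (locus N)) < net_diam (locus N)).
Proof.
split; split.
- move=> [S hS] u v; apply: hull_diam_not_straight => //.
  exact: shortcut_set_hull_diam hS.
- by move/(not_straight_hull_diam hconn); exact: hull_diam_shortcut_set.
- exact: not_straight_hull_diam.
- by move=> lt u v; exact: hull_diam_not_straight.
Qed.
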